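(* Let $F_3(x,y)$ be the free commutative automorphic loop of nilpotency class $3$ on free generators $x$, $y$. Let $u_1=(x,x,y)$, $u_2=(x,y,y)$, $v_1=(x,x,u_1)$, $v_2=(x,x,u_2)$, $v_3=(y,y,u_1)$, $v_4=(y,y,u_2)$. Then each element of $F_3(x,y)$ can be written uniquely as $(x^{a_1}y^{a_2}\cdot u_1^{a_3}u_2^{a_4})v_1^{a_5}v_2^{a_6}v_3^{a_7}v_4^{a_8}$ with $a_1,\dots,a_8\in\mathbb Z$, and $F_3(x,y)$ is isomorphic to $(\mathbb Z^8,* )$, where for $a=(a_1,\dots,a_8)$, $b=(b_1,\dots,b_8)\in\mathbb Z^8$ the product $a*b=(c_1,\dots,c_8)$ is given by \begin{align*} c_1&=a_1+b_1,\qquad c_2=a_2+b_2,\\ c_3&=a_3+b_3-a_1b_1(a_2+b_2),\qquad c_4=a_4+b_4+a_2b_2(a_1+b_1),\\ c_5&=a_5+b_5+(a_2+b_2)(b_1\alpha(a_1)+a_1\alpha(b_1))+a_2(a_1\beta(b_1)+b_1^2\beta(a_1))+b_2(b_1\beta(a_1)+a_1^2\beta(b_1))-a_1b_1(a_3+b_3),\\ c_6&=a_6+b_6+2a_1a_2b_1b_2(a_1+b_1)+(a_2+b_2)(a_1\beta(b_1)+b_1\beta(a_1))+(\beta(a_2)+\beta(b_2))(a_1b_1^2+b_1a_1^2)\\ &\quad-a_2b_2\alpha(a_1+b_1)-a_1b_1(a_4+b_4)-(a_3+b_3)(a_1b_2+a_2b_1),\\ c_7&=a_7+b_7-2a_1a_2b_1b_2(a_2+b_2)-(a_1+b_1)(a_2\beta(b_2)+b_2\beta(a_2))-(\beta(a_1)+\beta(b_1))(a_2b_2^2+b_2a_2^2)\\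 &\quad+a_1b_1\alpha(a_2+b_2)-a_2b_2(a_3+b_3)-(a_4+b_4)(a_1b_2+a_2b_1),\\ c_8&=a_8+b_8-(a_1+b_1)(a_2\alpha(b_2)+b_2\alpha(a_2))-a_1(a_2\beta(b_2)+b_2^2\beta(a_2))-b_1(b_2\beta(a_2)+a_2^2\beta(b_2))-a_2b_2(a_4+b_4), \end{align*} with $\alpha(n)=(n^3-n)/3$ and $\beta(n)=n^2-n$.
   Context: A loop is a set $Q$ with a binary operation (written as juxtaposition; $\cdot$ indicates lower priority, e.g. $ab\cdot c=(ab)c$) such that all left and right translations $L_a:b\mapsto ab$, $R_a:b\mapsto ba$ are bijections and there is a two-sided identity $1$. Maps are written on the right. The inner mapping group $\mathrm{Inn}(Q)$ is the stabilizer of $1$ in the group generated by all $L_a,R_a$; it is generated by $L_{a,b}=L_aL_bL_{ba}^{-1}$, $R_{a,b}=R_aR_bR_{ab}^{-1}$, $T_a=R_aL_a^{-1}$. $Q$ is automorphic if every inner mapping is an automorphism; automorphic loops are power-associative, so powers $a^n$, $n\in\mathbb Z$, are well defined. The associator $(a,b,c)$ is the unique element with $ab\cdot c=(a\cdot bc)(a,b,c)$. The center $Z(Q)$ is the set of elements fixed by all inner mappings; $Z_0=1$, $Z_{i+1}(Q)$ is the preimage of $Z(Q/Z_i(Q))$, and $Q$ has nilpotency class $n$ if $Z_{n-1}(Q)\ne Q=Z_n(Q)$. $F_3(x,y)$ denotes the free object on $x,y$ in the variety of commutative automorphic loops of nilpotency class at most $3$. In the canonical form the elements $v_i$ are central,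 so the expression is unambiguous. *)

(* Defs.v *)
From mathcomp Require Import all_boot all_order all_algebra.
Set Implicit Arguments. Unset Strict Implicit. Unset Printing Implicit Defensive.
Import Order.TTheory GRing.Theory Num.Theory.

(* A loop, given equationally: multiplication, identity, and left/right
   divisions, so that every L_a, R_a is a bijection (with inverses
   b |-> a \ b and b |-> b / a). *)
Record loop := Loop {
  carrier :> Type;
  lmul : carrier -> carrier -> carrier;
  lone : carrier;
  lldiv : carrier -> carrier -> carrier;
  lrdiv : carrier -> carrier -> carrier;
  lmul1x : forall a, lmul lone a = a;
  lmulx1 : forall a, lmul a lone = a;
  lmulK : forall a b, lmul a (lldiv a b) = b;
  lKmul : forall a b, lldiv a (lmul a b) = b;
  rmulK : forall a b, lmul (lrdiv b a) a = b;
  rKmul : forall a b, lrdiv (lmul b a) a = b }.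

Section LoopDefs.
Variable Q : loop.
Local Notation "a * b" := (lmul a b).
Local Notation "1" := (lone Q).

Inductive Mlt : (Q -> Q) -> Prop :=
  | Mlt_id : Mlt (fun x => x)
  | Mlt_L a f : Mlt f -> Mlt (fun x => a * f x)
  | Mlt_R a f : Mlt f -> Mlt (fun x => f x * a)
  | Mlt_Li a f : Mlt f -> Mlt (fun x => lldiv a (f x))
  | Mlt_Ri a f : Mlt f -> Mlt (fun x => lrdiv (f x) a).

Definition Inn (f : Q -> Q) : Prop := Mlt f /\ f 1 = 1.

Definition commutative_loop : Prop := forall a b : Q, a * b = b * a.

(* Every inner mapping is an automorphism (bijectivity holds since
   f is in Mlt(Q)). *)
Definition automorphic : Prop :=
  forall f, Inn f -> forall a b : Q, f (a * b) = f a * f b.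

(* Upper central series: Z_0 = 1, and a Z_i is in Z(Q/Z_i) iff every
   inner mapping f of Q satisfies f(a) Z_i = a Z_i, i.e. f(a) in a Z_i. *)
Fixpoint Zser (i : nat) (a : Q) : Prop :=
  match i with
  | 0 => a = 1
  | i'.+1 => forall f, Inn f -> exists n, Zser i' n /\ f a = a * n
  end.

Definition nilpotent_class_le (n : nat) : Prop := forall a : Q, Zser n a.

Definition assoc (a b c : Q) : Q := lldiv (a * (b * c)) ((a * b) * c).

Definition linv (a : Q) : Q := lldiv a 1.

Fixpoint npow (a : Q) (n : nat) : Q :=
  match n with 0 => 1 | n'.+1 => npow a n' * a end.

Definition zpow (a : Q) (z : int) : Q :=
  match z with Posz n => npow a n | Negz n => linv (npow a n.+1) end.

End LoopDefs.

Definition in_variety (Q : loop) : Prop :=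
  commutative_loop Q /\ automorphic Q /\ nilpotent_class_le Q 3.

Definition loop_hom (Q R : loop) (h : Q -> R) : Prop :=
  forall a b : Q, h (lmul a b) = lmul (h a) (h b).

Definition free_on2 (F : loop) (x y : F) : Prop :=
  in_variety F /\
  forall (Q : loop), in_variety Q -> forall q1 q2 : Q,
    (exists h : F -> Q, loop_hom h /\ h x = q1 /\ h y = q2) /\
    (forall h1 h2 : F -> Q, loop_hom h1 -> loop_hom h2 ->
       h1 x = q1 -> h1 y = q2 -> h2 x = q1 -> h2 y = q2 ->
       forall z, h1 z = h2 z).

Record Z8 := mkZ8 { z1 : int; z2 : int; z3 : int; z4 : int;
                    z5 : int; z6 : int; z7 : int; z8 : int }.

Local Open Scope ring_scope.

Definition alpha (n : int) : int := ((n ^+ 3 - n) %/ 3)%Z.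
Definition beta (n : int) : int := n ^+ 2 - n.

Definition z8mul (a b : Z8) : Z8 :=
  let: mkZ8 a1 a2 a3 a4 a5 a6 a7 a8 := a in
  let: mkZ8 b1 b2 b3 b4 b5 b6 b7 b8 := b in
  mkZ8
    (a1 + b1)
    (a2 + b2)
    (a3 + b3 - a1 * b1 * (a2 + b2))
    (a4 + b4 + a2 * b2 * (a1 + b1))
    (a5 + b5 + (a2 + b2) * (b1 * alpha a1 + a1 * alpha b1)
       + a2 * (a1 * beta b1 + b1 ^+ 2 * beta a1)
       + b2 * (b1 * beta a1 + a1 ^+ 2 * beta b1)
       - a1 * b1 * (a3 + b3))
    (a6 + b6 + 2 * a1 * a2 * b1 * b2 * (a1 + b1)
       + (a2 + b2) * (a1 * beta b1 + b1 * beta a1)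
       + (beta a2 + beta b2) * (a1 * b1 ^+ 2 + b1 * a1 ^+ 2)
       - a2 * b2 * alpha (a1 + b1) - a1 * b1 * (a4 + b4)
       - (a3 + b3) * (a1 * b2 + a2 * b1))
    (a7 + b7 - 2 * a1 * a2 * b1 * b2 * (a2 + b2)
       - (a1 + b1) * (a2 * beta b2 + b2 * beta a2)
       - (beta a1 + beta b1) * (a2 * b2 ^+ 2 + b2 * a2 ^+ 2)
       + a1 * b1 * alpha (a2 + b2) - a2 * b2 * (a3 + b3)
       - (a4 + b4) * (a1 * b2 + a2 * b1))
    (a8 + b8 - (a1 + b1) * (a2 * alpha b2 + b2 * alpha a2)
       - a1 * (a2 * beta b2 + b2 ^+ 2 * beta a2)
       - b1 * (b2 * beta a2 + a2 ^+ 2 * beta b2)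
       - a2 * b2 * (a4 + b4)).

Definition canon (F : loop) (x y : F) (a : Z8) : F :=
  let u1 := assoc x x y in
  let u2 := assoc x y y in
  let v1 := assoc x x u1 in
  let v2 := assoc x x u2 in
  let v3 := assoc y y u1 in
  let v4 := assoc y y u2 in
  lmul (lmul (lmul (lmul
    (lmul (lmul (zpow x (z1 a)) (zpow y (z2 a)))
          (lmul (zpow u1 (z3 a)) (zpow u2 (z4 a))))
    (zpow v1 (z5 a))) (zpow v2 (z6 a))) (zpow v3 (z7 a))) (zpow v4 (z8 a)).

(* Main.v *)
(* The loop of the theorem on Z^8 is in the variety, because its inner mappings
   c |-> (ab) \ (a(bc)) are automorphisms (a polynomial identity), and the
   canonical word with exponents a evaluates to a itself at the first two unit
   vectors.  Hence the homomorphism h from F to Z^8 given by freeness is a left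
   inverse of the canonical form, and everything follows, including the
   multiplication formula, once each element of F is known to be a canonical word.

   For that, let D(a,b,n) measure how the inner mapping of (a,b) moves n.  For n
   in Z_2(F) it is central, trilinear, and trivial when a or b is in the
   associator subloop.  As inner mappings are automorphisms, inn(x,y), which
   fixes x, commutes with inn(x,x), and inn(y,x) transforms inn(x,x) in a
   controlled way; this expresses all D(a,b,u_i) with a, b in {x,y} by
   v_1, ..., v_4.  The subloop N generated by the u_i and v_i is thus normal.
   Modulo N every inn(a,b) with a, b in {x,y} fixes x and y and so is trivial;
   the symmetries of the associator extend this to all a, b, so F/N is an
   abelian group generated by x and y. *)

Require Import Defs.
From mathcomp Require Import all_boot all_order all_algebra.
From mathcomp Require Import ring.
From Stdlib Require Import ProofIrrelevance.
Set Implicit Arguments. Unset Strict Implicit. Unset Printing Implicit Defensive.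
Import GRing.Theory.

(** * Loop identities, inner mappings and generated subloops *)

Section Loops.
Local Notation "a * b" := (lmul a b).
Local Notation "a \ b" := (lldiv a b) (at level 40, left associativity).
Variable Q : loop.
Implicit Types a b c d n m p q u x y z w : Q.

Lemma mulIl a b c : a * b = a * c -> b = c.
Proof. by move=> e; rewrite -(lKmul a b) e lKmul. Qed.

Lemma ldiv_eq a b c : a * b = c -> a \ c = b.
Proof. by move<-; rewrite lKmul. Qed.

Lemma ldivxx a : a \ a = lone Q.
Proof. exact/ldiv_eq/lmulx1. Qed.

Lemma assocE a b c : (a * (b * c)) * assoc a b c = (a * b) * c.
Proof. exact: lmulK. Qed.

(** This is $L_{b,a}$. By [Inn_factor], these mappings and their inverses generate all inner
    mappings of a commutative loop. *)
Definition inn a b c : Q := (a * b) \ (a * (b * c)).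

Lemma innE a b c : (a * b) * inn a b c = a * (b * c).
Proof. exact: lmulK. Qed.

Lemma Inn_inn a b : Inn (inn a b).
Proof. by split; [do !constructor | rewrite /inn !lmulx1 ldivxx]. Qed.

(** The inverse of [inn a b]; it absorbs the divisions occurring in [Mlt]. *)
Definition inni a b c : Q := b \ (a \ ((a * b) * c)).

(* The discrepancy of the triple (a, b, c), i.e. the inverse of the associator
   up to a central factor when Q has class 3; unlike [assoc] it is the quotient
   of an automorphism by the identity. *)
Definition D a b c : Q := c \ inn a b c.

Lemma innD a b c : inn a b c = c * D a b c.
Proof. by rewrite lmulK. Qed.

Lemma DE a b c : (a * b) * (c * D a b c) = a * (b * c).
Proof. by rewrite -innD innE. Qed.

Definition central z := forall f : Q -> Q, Inn f -> f z = z.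

Definition second_central n :=
  forall f : Q -> Q, Inn f -> exists2 z, central z & f n = n * z.

Inductive gen (A : Q -> Prop) : Q -> Prop :=
  | gen_in a : A a -> gen A a
  | gen_one : gen A (lone Q)
  | gen_mul a b : gen A a -> gen A b -> gen A (a * b)
  | gen_ldiv a b : gen A a -> gen A b -> gen A (a \ b).

Lemma gen_cancel A a b : gen A a -> gen A (a * b) -> gen A b.
Proof. by move=> ga gab; rewrite -(lKmul a b); apply: gen_ldiv. Qed.

End Loops.

(** * Subloops that are abelian groups modulo a congruence *)

Section AbelianModulo.
Local Notation "a * b" := (lmul a b).
Local Notation "a \ b" := (lldiv a b) (at level 40, left associativity).
Variable Q : loop.
Hypothesis Qc : commutative_loop Q.

(* Used with P = everything and E = congruence modulo N, and with P = the
   associator elements and E = equality. *)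
Record abelian_mod (P : Q -> Prop) (E : Q -> Q -> Prop) : Prop := AbelianMod {
  am1 : P (lone Q);
  amM : forall a b, P a -> P b -> P (a * b);
  amV : forall a b, P a -> P b -> P (a \ b);
  am_refl : forall a, E a a;
  am_sym : forall a b, E a b -> E b a;
  am_trans : forall b a c, E a b -> E b c -> E a c;
  am_mul : forall a a' b b', E a a' -> E b b' -> E (a * b) (a' * b');
  am_cancel : forall a b b', E (a * b) (a * b') -> E b b';
  am_assoc : forall a b c, P a -> P b -> P c -> E ((a * b) * c) (a * (b * c)) }.

Variables (P : Q -> Prop) (E : Q -> Q -> Prop).
Hypothesis PE : abelian_mod P E.
Let refl := am_refl PE.
Let sym := am_sym PE.
Let trans := am_trans PE.

Lemma am_comm a b : E (a * b) (b * a).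
Proof. by rewrite Qc; apply: refl. Qed.

Lemma am_npow a n : P a -> P (npow a n).
Proof. by move=> Pa; elim: n => [|n IH] /=; [exact: (am1 PE) | exact: (amM PE)]. Qed.

Lemma am_zpow a i : P a -> P (zpow a i).
Proof.
move=> Pa; case: i => n /=; first exact: am_npow.
exact: (amV PE (amM PE (am_npow n Pa) Pa) (am1 PE)).
Qed.

Lemma am_zpowS a i : P a -> E (zpow a (i + 1)%R) (zpow a i * a).
Proof.
move=> Pa; have Pz n : P (linv (npow a n)) by apply: (amV PE) (am1 PE); apply: am_npow.
case: i => n; first by rewrite -PoszD addn1; apply: refl.
(* Exponent -1 is separate because its successor 0 changes the constructor of [int]. *)
case: n => [|n].
  have -> : (Negz 0 + 1)%R = Posz 0 by [].
  by rewrite /= lmul1x Qc /linv lmulK; apply: refl.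
have -> : (Negz n.+1 + 1)%R = Negz n by rewrite !NegzE -addn1 PoszD opprD subrK.
rewrite /zpow; set b := linv (npow a n.+2).
apply: (am_cancel PE (a := npow a n.+1)); apply: trans (sym _).
  rewrite /linv lmulK; apply: refl.
have Pn : P (npow a n.+1) by apply: am_npow.
apply: (trans (b := npow a n.+1 * (a * b))); first by apply: (am_mul PE) (refl _) (am_comm _ _).
apply: trans (sym (am_assoc PE Pn Pa (Pz _))) _.
by rewrite [X in E X _]lmulK; apply: refl.
Qed.

Lemma am_zpowD a i j : P a -> E (zpow a (i + j)%R) (zpow a i * zpow a j).
Proof.
move=> Pa.
(* The law at k and the law at k + 1 are equivalent, so the induction can run upwards and
   downwards. *)
have step k : E (zpow a (i + (k + 1))%R) (zpow a i * zpow a (k + 1)%R) <->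
              E (zpow a (i + k)%R) (zpow a i * zpow a k).
  have e1 : E (zpow a (i + (k + 1))%R) (a * zpow a (i + k)%R).
    by rewrite addrA Qc; apply: am_zpowS.
  have e2 : E (zpow a i * zpow a (k + 1)%R) (a * (zpow a i * zpow a k)).
    apply: trans (am_mul PE (refl _) (am_zpowS k Pa)) _.
    rewrite [X in E _ X]Qc; apply: sym.
    by apply: (am_assoc PE) => //; apply: am_zpow.
  split=> e; last first.
    by apply: trans e1 _; apply: trans _ (sym e2); apply: (am_mul PE).
  by apply: (am_cancel PE (a := a)); apply: trans (sym e1) (trans e e2).
elim/int_rec: j => [|n IH|n IH].
- by rewrite addr0 /= lmulx1; apply: refl.
- by rewrite -addn1 PoszD; apply/step.
- by apply/step; rewrite -addn1 PoszD opprD subrK.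
Qed.

Definition saturated_subloop (A : Q -> Prop) : Prop :=
  [/\ forall a, A a -> P a, A (lone Q),
      forall a b, A a -> A b -> A (a * b),
      forall a b, A a -> A b -> A (a \ b) &
      forall a b, P b -> E a b -> A a -> A b].

(** Modulo E, the subloop generated by a saturated A and g. Iterating it along a list of generators
    produces normal forms, one power per generator. *)
Definition extend (A : Q -> Prop) g w : Prop :=
  P w /\ exists p i, A p /\ E w (p * zpow g i).

Lemma am_ACA a b c d : P a -> P b -> P c -> P d ->
  E ((a * b) * (c * d)) ((a * c) * (b * d)).
Proof.
move=> Pa Pb Pc Pd.
apply: trans (am_assoc PE Pa Pb (amM PE Pc Pd)) _.
apply: trans _ (sym (am_assoc PE Pa Pc (amM PE Pb Pd))).
apply: (am_mul PE) => //; apply: trans (sym (am_assoc PE Pb Pc Pd)) _.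
apply: trans _ (am_assoc PE Pc Pb Pd).
by apply: (am_mul PE) (am_comm _ _) _.
Qed.

Lemma saturated_extend A g :
  P g -> saturated_subloop A -> saturated_subloop (extend A g).
Proof.
move=> Pg [AP A1 AM AV AE].
have PM := amM PE; have PV := amV PE; have Pz i := am_zpow i Pg.
split.
- by move=> a [].
- by split; [apply: am1 PE | exists (lone Q), 0%R; rewrite /= lmulx1; split].
- move=> a b [Pa [p [i [Ap e]]]] [Pb [q [j [Aq e']]]]; split; first exact: PM.
  exists (p * q), (i + j)%R; split; first exact: AM.
  apply: trans (am_mul PE e e') _.
  apply: trans (am_ACA _ _ _ _) _; rewrite ?Pz; try exact: AP; try exact: Pz.
  by apply: (am_mul PE) => //; apply: sym; apply: am_zpowD.
- move=> a b [Pa [p [i [Ap e]]]] [Pb [q [j [Aq e']]]]; split; first exact: PV.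
  exists (p \ q), (j - i)%R; split; first exact: AV.
  apply: (am_cancel PE (a := a)); rewrite lmulK; apply: trans e' _.
  apply: sym; apply: trans (am_mul PE e (refl _)) _.
  apply: trans (am_ACA _ _ _ _) _; try exact: AP; try exact: Pz.
    exact/AP/AV.
  rewrite lmulK; apply: (am_mul PE) => //; apply: trans (sym (am_zpowD _ _ Pg)) _.
  by rewrite addrC subrK; apply: refl.
- move=> a b Pb e [Pa [p [i [Ap e']]]]; split=> //; exists p, i; split=> //.
  exact: trans (sym e) e'.
Qed.

Lemma extend_gen A g : P g -> A (lone Q) -> extend A g g.
Proof.
move=> Pg A1; split=> //; exists (lone Q), 1%R; split=> //.
by rewrite /= !lmul1x; apply: refl.
Qed.

Lemma sub_extend A g w : saturated_subloop A -> A w -> extend A g w.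
Proof.
move=> [AP _ _ _ _] Aw; split; first exact: AP.
by exists w, 0%R; rewrite /= lmulx1.
Qed.

Lemma saturated_trivial : saturated_subloop (fun w => P w /\ E w (lone Q)).
Proof.
split.
- by move=> a [].
- by split; [apply: am1 PE | apply: refl].
- move=> a b [Pa e] [Pb e']; split; first exact: (amM PE).
  by rewrite -[X in E _ X]lmul1x; apply: (am_mul PE).
- move=> a b [Pa e] [Pb e']; split; first exact: (amV PE).
  apply: (am_cancel PE (a := a)); rewrite lmulK lmulx1.
  exact: trans e' (sym e).
- by move=> a b Pb e [Pa e']; split=> //; apply: trans (sym e) e'.
Qed.

Lemma gen_sub_saturated A B :
  (forall a, B a -> A a) -> saturated_subloop A -> forall w, gen B w -> A w.
Proof.
move=> BA [AP A1 AM AV AE] w; elim=> [a /BA|//|a b _ Aa _ Ab|a b _ Aa _ Ab] //.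
  exact: AM.
exact: AV.
Qed.

End AbelianModulo.

(** * Commutative automorphic loops of class three *)

Section Automorphic.
Local Notation "a * b" := (lmul a b).
Local Notation "a \ b" := (lldiv a b) (at level 40, left associativity).
Variable Q : loop.
Hypotheses (Qc : commutative_loop Q) (Qa : automorphic Q).
Implicit Types a b c d n m p q u x y z w : Q.
Local Notation "1" := (lone Q).

Lemma InnM f (If : Inn f) a b : f (a * b) = f a * f b.
Proof. exact: Qa. Qed.

Lemma InnV f (If : Inn f) a b : f (a \ b) = f a \ f b.
Proof. by apply/esym/ldiv_eq; rewrite -(InnM If) lmulK. Qed.

Lemma innM a b c d : inn a b (c * d) = inn a b c * inn a b d.
Proof. exact: InnM (Inn_inn a b) c d. Qed.

Lemma Inn_conj f a b c : Inn f -> f (inn a b c) = inn (f a) (f b) (f c).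
Proof. by move=> If; rewrite /inn (InnV If) !(InnM If). Qed.

Lemma mulAz a b z : central z -> a * (b * z) = a * b * z.
Proof. by move=> cz; rewrite -innE (cz _ (Inn_inn a b)). Qed.

Lemma mulzAC a b z : central z -> a * z * b = a * b * z.
Proof. by move=> cz; rewrite Qc mulAz // (Qc b). Qed.

Lemma central1 : central 1.
Proof. by move=> f []. Qed.

Lemma centralM z w : central z -> central w -> central (z * w).
Proof. by move=> cz cw f If; rewrite (InnM If) cz // cw. Qed.

Lemma centralV z w : central z -> central w -> central (z \ w).
Proof. by move=> cz cw f If; rewrite (InnV If) cz // cw. Qed.

Lemma mul_zz a b z w : central z -> central w -> (a * z) * (b * w) = (a * b) * (z * w).
Proof. by move=> cz cw; rewrite mulAz // (mulzAC _ _ cz) -mulAz. Qed.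

Lemma second_of_central z : central z -> second_central z.
Proof. by move=> cz f If; exists 1; [apply: central1 | rewrite cz ?lmulx1]. Qed.

Lemma second1 : second_central 1.
Proof. exact/second_of_central/central1. Qed.

Lemma secondM n m : second_central n -> second_central m -> second_central (n * m).
Proof.
move=> sn sm f If; have [z cz e] := sn f If; have [w cw e'] := sm f If.
by exists (z * w); [apply: centralM | rewrite (InnM If) e e' mul_zz].
Qed.

Lemma secondV n m : second_central n -> second_central m -> second_central (n \ m).
Proof.
move=> sn sm f If; have [z cz e] := sn f If; have [w cw e'] := sm f If.
have czw := centralV cz cw; exists (z \ w) => //.
by rewrite (InnV If) e e'; apply: ldiv_eq; rewrite mul_zz // !lmulK.
Qed.

Lemma centralD a b n : second_central n -> central (D a b n).
Proof. by move=> /(_ _ (Inn_inn a b)) [z cz e]; rewrite /D e lKmul. Qed.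

Lemma second_mulE a b n :
  second_central n -> a * (b * n) = a * b * n * D a b n.
Proof. by move=> sn; rewrite -DE mulAz //; apply: centralD. Qed.

Lemma DM3 a b n m : second_central n -> second_central m ->
  D a b (n * m) = D a b n * D a b m.
Proof.
by move=> sn sm; apply: ldiv_eq; rewrite innM !innD -mul_zz //; apply: centralD.
Qed.

(** Commutativity turns the triple (n, b, a) into the reversal of (a, b, n), so [inn n b] moves a by
    the inverse of [D a b n]. *)
Lemma inn_second_l n b a : second_central n -> inn n b a * D a b n = a.
Proof.
move=> sn; apply: (mulIl (a := n * b)); have cD := centralD a b sn.
by rewrite mulAz // innE (Qc (n * b)) (Qc n b) (second_mulE a b sn) (Qc n) (Qc b a).
Qed.

Lemma inn_second_r a n b :
  second_central n -> inn a n b * D b a n = b * D a b n.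
Proof.
move=> sn; apply: (mulIl (a := a * n)).
have cD := centralD a b sn; have cD' := centralD b a sn.
rewrite !mulAz // innE (Qc n b) (second_mulE a b sn) (Qc (a * n)) (second_mulE b a sn).
by rewrite (Qc b a) [LHS]mulzAC.
Qed.

(** By [inn_second_l], [D a b n] measures how the automorphism [inn n b] moves a by a central
    factor; such a factor is multiplicative in a. *)
Lemma D1 a a' b n : second_central n -> D (a * a') b n = D a b n * D a' b n.
Proof.
move=> sn; apply: (mulIl (a := inn n b (a * a'))).
rewrite inn_second_l // innM -mul_zz ?inn_second_l //; exact: centralD.
Qed.

(** The automorphism [inn a n] moves b by the quotient of [D a b n] by [D b a n]. The latter is
    multiplicative in b by [D1], hence so is the former. *)
Lemma D2 a b b' n : second_central n -> D a (b * b') n = D a b n * D a b' n.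
Proof.
move=> sn; apply: (mulIl (a := b * b')).
have cD c d := centralD c d sn.
rewrite -inn_second_r // innM D1 // -(mul_zz (inn a n b)) ?inn_second_r //.
exact: mul_zz.
Qed.

Lemma D_central a b z : central z -> D a b z = 1.
Proof. by move=> cz; rewrite /D (cz _ (Inn_inn a b)) ldivxx. Qed.

Lemma D_inv a b n m : second_central n -> second_central m ->
  central (n * m) -> D a b n * D a b m = 1.
Proof. by move=> sn sm cz; rewrite -DM3 // D_central. Qed.

(* A substitute for membership in the associator subloop: triviality under
   homomorphisms into the center, such as D in each of its first two arguments,
   is all that is needed of it. *)
Definition derived n : Prop := second_central n /\
  forall f : Q -> Q, (forall a, central (f a)) -> {morph f : a b / a * b} -> f n = 1.

Lemma derived1 : derived 1.
Proof.
split; first exact: second1.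
by move=> f cf fM; apply: (mulIl (a := f 1)); rewrite -fM !lmulx1.
Qed.

Lemma derivedM n m : derived n -> derived m -> derived (n * m).
Proof.
move=> [sn dn] [sm dm]; split; first exact: secondM.
by move=> f cf fM; rewrite fM dn // dm // lmulx1.
Qed.

Lemma derivedV n m : derived n -> derived m -> derived (n \ m).
Proof.
move=> [sn dn] [sm dm]; split; first exact: secondV.
move=> f cf fM; apply: (mulIl (a := f n)); rewrite -fM lmulK.
by rewrite dn // dm // lmulx1.
Qed.

Lemma D_derived1 m b n : derived m -> second_central n -> D m b n = 1.
Proof.
move=> [sm dm] sn; apply: (dm (fun a => D a b n)) => [a|a a'].
  exact: centralD.
exact: D1.
Qed.

Lemma D_derived2 a m n : derived m -> second_central n -> D a m n = 1.
Proof.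
move=> [sm dm] sn; apply: (dm (fun b => D a b n)) => [b|b b'].
  exact: centralD.
exact: D2.
Qed.

Lemma derivedA a n m : derived n -> second_central m -> a * n * m = a * (n * m).
Proof. by move=> dn sm; rewrite second_mulE // D_derived2 // lmulx1. Qed.

Lemma derivedAC a n m : derived n -> derived m -> a * n * m = a * m * n.
Proof.
move=> dn dm; have [sn _] := dn; have [sm _] := dm.
by rewrite !derivedA // (Qc n).
Qed.

Lemma derived_mul2 a b n m : derived n -> derived m ->
  (a * n) * (b * m) = (a * b) * (n * m) * (D a b m * D b a n).
Proof.
move=> dn dm; have [sn _] := dn; have [sm _] := dm.
have cD := centralD a b sm; have cD' := centralD b a sn.
rewrite second_mulE // D1 // (D_derived1 _ dn) // lmulx1 (Qc _ b) second_mulE //.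
rewrite (mulzAC _ _ cD') (Qc b a) (derivedA _ dn sm).
by rewrite (Qc (D a b m)) (mulAz _ _ cD).
Qed.

(* Nilpotency of class at most 3. *)
Hypothesis Q2 : forall f, Inn f ->
  forall a : Q, exists2 n, second_central n & f a = a * n.

Lemma second_D a b c : second_central (D a b c).
Proof.
by have [n sn e] := Q2 (Inn_inn a b) c; rewrite /D e lKmul.
Qed.

(** A homomorphism into the center takes both bracketings of a triple to the same element, hence
    kills their discrepancy. *)
Lemma derived_D a b c : derived (D a b c).
Proof.
split; first exact: second_D.
move=> f cf fM; apply: (mulIl (a := f a * f b * f c)).
by rewrite lmulx1 -(mulAz _ (f c) (cf _)) -(mulAz _ (f b) (cf _)) -!fM DE.
Qed.

Lemma mulIr a b c : b * a = c * a -> b = c.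
Proof. by rewrite !(Qc _ a) => /mulIl. Qed.

Lemma inn_flex x y : inn x y x = x.
Proof. by apply: ldiv_eq; rewrite (Qc y) (Qc x (x * y)). Qed.

(* [inn x y] fixes [x], so it commutes with [inn x x]. *)
Lemma D_inn_comm x y : D x y (D x x y) = D x x (D x y y).
Proof.
have := Inn_conj x x y (Inn_inn x y); rewrite inn_flex.
set p := D x x y; set n := D x y y.
have [dp dn] : derived p /\ derived n by split; apply: derived_D.
have [[sp _] [sn _]] := (dp, dn).
have [cp cn] := (centralD x y sp, centralD x x sn).
rewrite [inn x x y]innD innM [inn x y y]innD -/p -/n innM [inn x x y]innD -/p.
rewrite !innD !mulAz // (derivedAC _ dn dp).
exact: mulIl.
Qed.

(** Up to central factors, p leads from (xx)y to x(xy) and q leads back, so pq is the inverse of a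
    central element. *)
Lemma D_opposite x y : central (D x x y * D y x x).
Proof.
set p := D x x y; set q := D y x x.
have [dp dq] : derived p /\ derived q by split; apply: derived_D.
have [[sp _] [sq _]] := (dp, dq).
have cE := centralD (x * x) y sp; have cF := centralD (x * y) x sq.
have e1 : x * x * y * p * D (x * x) y p = x * (x * y).
  by rewrite -second_mulE // DE.
have e2 : x * (x * y) * q * D (x * y) x q = x * x * y.
  by rewrite (Qc x (x * y)) -second_mulE // (Qc x y) DE (Qc y).
have e : (p * q) * (D (x * x) y p * D (x * y) x q) = 1.
  apply: (mulIl (a := x * x * y)); rewrite lmulx1 -{2}e2 -e1.
  rewrite (mulAz _ _ (centralM cE cF)) (mulAz _ _ cF).
  by rewrite (mulzAC _ q cE) (derivedA _ dp sq).
rewrite -[_ * q](lKmul (D (x * x) y p * D (x * y) x q)) (Qc _ (p * q)) e.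
apply: centralV; [exact: centralM | exact: central1].
Qed.

(* Apply the automorphism [inn y x], which fixes [y], to the equation defining
   [D x x y]. *)
Lemma D_swap x y : D y x (D y x x) = D x y (D y x x).
Proof.
set q := D y x x; set p := D x x y.
have [dp dq] : derived p /\ derived q by split; apply: derived_D.
have [[sp _] [sq _]] := (dp, dq).
have dqq := derivedM dq dq; have [sqq _] := dqq.
have PB : D y x q * D y x p = 1.
  by apply: D_inv => //; rewrite (Qc q); apply: D_opposite.
have := congr1 (inn y x) (DE x x y); rewrite !innM inn_flex !innD -/p -/q.
rewrite (derived_mul2 _ _ dq dq) (Qc (x * q) y) (second_mulE y x sq).
rewrite (mulAz (x * q) _ (centralD y x sq)).
move: (centralD x x sq) (centralD y x sq) (centralD x y sq) (centralD y x sp) PB.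
move: (centralD (x * x) y sp) => cE cA cB cC cP PB.
rewrite (derived_mul2 x (y * x) dq dq) (mulzAC _ _ (centralM cA cA)).
rewrite (mulAz y p cP) (mulAz _ (y * p) cP) (derived_mul2 (x * x) y dqq dp).
rewrite (D1 _ _ _ sq) !(D2 _ _ _ sq) !(D2 _ _ _ sqq) !(DM3 _ _ sq sq).
have -> : x * (y * x) = x * x * y * p * D (x * x) y p.
  by rewrite -(second_mulE (x * x) y sp) DE (Qc y).
move: cE cA cB cC cP PB.
set A := D x x q; set B := D y x q; set C := D x y q.
set E := D (x * x) y p; set P := D y x p => cE cA cB cC cP PB.
rewrite !(mulzAC _ _ cE) (derivedA _ dp sqq) (Qc p).
(* Once the central factors are sorted, the two sides differ only in B^4 P against B^2 C. As B P =
   1, this leaves B = C. *)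
rewrite !(mulAz _ _ cA, mulAz _ _ cB, mulAz _ _ cC, mulAz _ _ (centralM cB cB)).
rewrite !(mulzAC _ A cB, mulzAC _ A cC, mulzAC _ A cP, mulzAC _ A cE, mulzAC _ B cC,
  mulzAC _ B cE, mulzAC _ C cE, mulzAC _ P cE) => /mulIr.
by rewrite -(mulAz _ B cP) PB lmulx1 => /mulIl.
Qed.

(** Solve [DE] for (ab)c. The second factor is the central price of moving the discrepancy past
    (ab)c. *)
Lemma assoc_D a b c :
  assoc a b c = (D a b c \ 1) * (D (a * b) c (D a b c) \ 1).
Proof.
have dn := derived_D a b c; set n := D a b c in dn *.
have [sn _] := dn; have cE := centralD (a * b) c sn.
set E := D _ _ _ in cE *; have cE' := centralV cE central1.
have s' : second_central (n \ 1) by apply: secondV second1.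
apply: ldiv_eq; rewrite -(DE a b c) -/n (second_mulE _ _ sn) -/E (mulzAC _ _ cE).
rewrite (derivedA _ dn (secondM s' (second_of_central cE'))) (mulAz _ _ cE').
by rewrite lmulK lmul1x -(mulAz _ _ cE) (Qc _ E) lmulK lmulx1.
Qed.

Lemma derived_assoc a b c : derived (assoc a b c).
Proof.
rewrite assoc_D; apply: derivedM; apply: derivedV; try exact: derived_D; exact: derived1.
Qed.

Lemma D_assoc_central a b c : central (D a b c * assoc a b c).
Proof.
have [sn _] := derived_D a b c; have cE := centralD (a * b) c sn.
have cE' := centralV cE central1.
by rewrite assoc_D (mulAz _ _ cE') lmulK lmul1x.
Qed.

Lemma D_assoc_inv a b n : second_central n -> D a b n * assoc a b n = 1.
Proof.
move=> sn; apply: (mulIl (a := a * b * n)); rewrite lmulx1.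
have cD := centralD a b sn.
by rewrite (Qc (D a b n)) (mulAz _ _ cD) -(mulzAC _ _ cD) -(second_mulE _ _ sn) assocE.
Qed.

Lemma assoc_central a b n : second_central n -> central (assoc a b n).
Proof.
move=> sn; rewrite -(ldiv_eq (D_assoc_inv a b sn)).
exact: centralV (centralD a b sn) central1.
Qed.

Lemma derived_mod_eq : abelian_mod derived (@eq Q).
Proof.
split; try by congruence.
- exact: derived1.
- exact: derivedM.
- exact: derivedV.
- by move=> a b b' /mulIl.
- by move=> a b c _ db [sc _]; apply: derivedA.
Qed.

(** * The subloop N generated by the associators, and the quotient by it *)

Section TwoGenerators.
Variables x y : Q.
Hypothesis gen_xy : forall w, gen (fun c => c = x \/ c = y) w.
Local Notation u1 := (assoc x x y).
Local Notation u2 := (assoc x y y).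
Local Notation v1 := (assoc x x u1).
Local Notation v2 := (assoc x x u2).
Local Notation v3 := (assoc y y u1).
Local Notation v4 := (assoc y y u2).

Definition generator_v w := [\/ w = v1, w = v2, w = v3 | w = v4].
Definition generator_uv w := [\/ w = u1, w = u2 | generator_v w].
Local Notation V := (gen generator_v).
Local Notation N := (gen generator_uv).

Lemma V_D_opp a b n m : second_central n -> second_central m ->
  central (n * m) -> V (D a b n) -> V (D a b m).
Proof.
move=> sn sm cnm Vn; apply: (gen_cancel Vn); rewrite D_inv //; exact: gen_one.
Qed.

(** With a = b the values are the inverses of the v_i. For mixed pairs, [D_opposite] and
    [D_assoc_central] let u1, p1, q1, and likewise u2, p2, q2, replace one another up to inversion.
    Then [D_inn_comm] reduces the pair (x, y) on p1 to (x, x) on q2, and (y, x) on p2 to (y, y) on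
    q1; [D_swap] gives the two remaining cases. *)
Lemma V_D_generators a b :
  (a = x \/ a = y) -> (b = x \/ b = y) -> V (D a b u1) /\ V (D a b u2).
Proof.
have [[s1 _] [s2 _]] := (derived_assoc x x y, derived_assoc x y y).
have Vu a' n : second_central n -> V (assoc a' a' n) -> V (D a' a' n).
  move=> sn Vn; apply: (gen_cancel Vn); rewrite Qc D_assoc_inv //; exact: gen_one.
have Vx1 : V (D x x u1) by apply: Vu => //; apply/gen_in/Or41.
have Vx2 : V (D x x u2) by apply: Vu => //; apply/gen_in/Or42.
have Vy1 : V (D y y u1) by apply: Vu => //; apply/gen_in/Or43.
have Vy2 : V (D y y u2) by apply: Vu => //; apply/gen_in/Or44.
set p1 := D x x y; set q1 := D y x x; set p2 := D y y x; set q2 := D x y y.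
have [sp1 sq1] : second_central p1 /\ second_central q1 by split; apply: second_D.
have [sp2 sq2] : second_central p2 /\ second_central q2 by split; apply: second_D.
have cu1 : central (p1 * u1) by apply: D_assoc_central.
have cu2 : central (q2 * u2) by apply: D_assoc_central.
have c1 : central (p1 * q1) by apply: D_opposite.
have c2 : central (p2 * q2) by apply: D_opposite.
have u1_to_q1 a' b' : V (D a' b' u1) -> V (D a' b' q1).
  by move=> H; apply: (V_D_opp sp1 sq1 c1); apply: V_D_opp H; rewrite // Qc.
have q1_to_u1 a' b' : V (D a' b' q1) -> V (D a' b' u1).
  by move=> H; apply: (V_D_opp sp1 s1 cu1); apply: V_D_opp H; rewrite // Qc.
have u2_to_q2 a' b' : V (D a' b' u2) -> V (D a' b' q2).
  by apply: V_D_opp => //; rewrite Qc.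
have q2_to_u2 a' b' : V (D a' b' q2) -> V (D a' b' u2) by apply: V_D_opp.
have xy1 : V (D x y q1).
  by apply: (V_D_opp sp1 sq1 c1); rewrite D_inn_comm; apply: u2_to_q2.
have yx1 : V (D y x q1) by rewrite D_swap.
have yx2 : V (D y x q2).
  by apply: (V_D_opp sp2 sq2 c2); rewrite D_inn_comm; apply: u1_to_q1.
have xy2 : V (D x y q2) by rewrite D_swap.
by case=> -> [] ->; split; do ?[exact: q1_to_u1 | exact: q2_to_u2].
Qed.

Lemma V_D a b n : second_central n ->
  (forall a b, (a = x \/ a = y) -> (b = x \/ b = y) -> V (D a b n)) -> V (D a b n).
Proof.
move=> sn H.
have Hx c d : (d = x \/ d = y) -> V (D c d n).
  move=> dxy; elim: (gen_xy c) => [c' c'xy||c1 c2 _ IH1 _ IH2|c1 c2 _ IH1 _ IH2].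
  - exact: H.
  - by rewrite D_derived1 //; [apply: gen_one | apply: derived1].
  - by rewrite D1 //; apply: gen_mul.
  by apply: (gen_cancel IH1); rewrite -D1 // lmulK.
elim: (gen_xy b) => [c' c'xy||c1 c2 _ IH1 _ IH2|c1 c2 _ IH1 _ IH2].
- exact: Hx.
- by rewrite D_derived2 //; [apply: gen_one | apply: derived1].
- by rewrite D2 //; apply: gen_mul.
by apply: (gen_cancel IH1); rewrite -D2 // lmulK.
Qed.

Lemma generator_v_central w : generator_v w -> central w.
Proof.
have [[s1 _] [s2 _]] := (derived_assoc x x y, derived_assoc x y y).
by case=> ->; apply: assoc_central.
Qed.

Lemma N_derived n : N n -> derived n.
Proof.
elim=> [w|||]; last 3 first.
- exact: derived1.
- by move=> a b _ da _ db; apply: derivedM.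
- by move=> a b _ da _ db; apply: derivedV.
by case=> [->|->|[]->]; apply: derived_assoc.
Qed.

Lemma V_sub_N w : V w -> N w.
Proof.
elim=> [a Va||a b _ Na _ Nb|a b _ Na _ Nb].
- exact/gen_in/Or33.
- exact: gen_one.
- exact: gen_mul.
exact: gen_ldiv.
Qed.

(** This is the normality of N: the correction factors arising when cosets are multiplied or
    cancelled stay in N. *)
Lemma V_D_N a b n : N n -> V (D a b n).
Proof.
elim=> [w|||].
- case=> [->|->|/generator_v_central cw]; last by rewrite D_central //; apply: gen_one.
    by apply: V_D => [|c d cxy /(V_D_generators cxy)[]//]; case: (derived_assoc x x y).
  by apply: V_D => [|c d cxy /(V_D_generators cxy)[]//]; case: (derived_assoc x y y).
- by rewrite D_central; [apply: gen_one | apply: central1].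
- move=> n1 n2 N1 IH1 N2 IH2; have [[s1 _] [s2 _]] := (N_derived N1, N_derived N2).
  by rewrite DM3 //; apply: gen_mul.
- move=> n1 n2 N1 IH1 N2 IH2; have [[s1 _] [s2 _]] := (N_derived N1, N_derived N2).
  apply: (gen_cancel IH1); rewrite -DM3 ?lmulK //; exact: secondV.
Qed.

Definition mod_N a b := exists2 n, N n & b = a * n.

Lemma mod_N_mul a a' b b' : mod_N a a' -> mod_N b b' -> mod_N (a * b) (a' * b').
Proof.
move=> [n Nn ->] [m Nm ->]; have [dn dm] := (N_derived Nn, N_derived Nm).
have [[sn _] [sm _]] := (dn, dm).
exists (n * m * (D a b m * D b a n)).
  by apply: gen_mul; [apply: gen_mul | apply/V_sub_N/gen_mul; apply: V_D_N].
by rewrite derived_mul2 // -mulAz //; apply: centralM; apply: centralD.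
Qed.

Lemma mod_N_cancel a b b' : mod_N (a * b) (a * b') -> mod_N b b'.
Proof.
move=> [n Nn e]; have [sn _] := N_derived Nn.
have cD := centralD a b sn; have cD' := centralV cD central1.
exists (n * (D a b n \ 1)).
  by apply: gen_mul => //; apply: gen_ldiv; [apply/V_sub_N/V_D_N | apply: gen_one].
apply: (mulIl (a := a)); rewrite e (mulAz b _ cD') (mulAz a _ cD') second_mulE //.
by rewrite -[RHS]mulAz // lmulK lmulx1.
Qed.

Lemma mod_N_refl a : mod_N a a.
Proof. by exists 1; [apply: gen_one | rewrite lmulx1]. Qed.

Lemma mod_N_sym a b : mod_N a b -> mod_N b a.
Proof.
move=> [n Nn ->]; have N' : N (n \ 1) by apply: gen_ldiv => //; apply: gen_one.
exists (n \ 1) => //; have [s' _] := N_derived N'.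
by rewrite derivedA ?lmulK ?lmulx1 //; apply: N_derived.
Qed.

Lemma mod_N_trans b a c : mod_N a b -> mod_N b c -> mod_N a c.
Proof.
move=> [n Nn ->] [m Nm ->]; exists (n * m); first exact: gen_mul.
by have [sm _] := N_derived Nm; rewrite derivedA //; apply: N_derived.
Qed.

Lemma mod_N_of_eq a b : a = b -> mod_N a b.
Proof. by move->; apply: mod_N_refl. Qed.

Local Notation assoc_mod a b c := (mod_N (a * b * c) (a * (b * c))).

(** The triple (a, b, d) associates modulo N exactly when [inn a b] fixes d modulo N, and the
    elements fixed by an automorphism form a subloop. *)
Lemma assoc_mod_gen a b c : assoc_mod a b x -> assoc_mod a b y -> assoc_mod a b c.
Proof.
have E d : assoc_mod a b d <-> mod_N d (inn a b d).
  rewrite -innE; split; first exact: mod_N_cancel.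
  exact: mod_N_mul (mod_N_refl _).
move=> /E Ex /E Ey; apply/E.
elim: (gen_xy c) => [d [->|->]||c1 c2 _ IH1 _ IH2|c1 c2 _ IH1 _ IH2] //.
- by case: (Inn_inn a b) => _ ->; apply: mod_N_refl.
- by rewrite innM; apply: mod_N_mul.
apply: (mod_N_cancel (a := c1)); rewrite lmulK; apply: (mod_N_trans IH2).
rewrite -{1}(lmulK c1 c2) innM.
exact: mod_N_mul (mod_N_sym IH1) (mod_N_refl _).
Qed.

Lemma assoc_mod_rev a b c : assoc_mod a b c -> assoc_mod c b a.
Proof. by move/mod_N_sym; rewrite (Qc a (b * c)) (Qc b c) (Qc (a * b) c) (Qc a b). Qed.

(** Up to commutativity a triple has three bracketings; two congruences between them imply the
    third. *)
Lemma assoc_mod_rot a b c : assoc_mod a b c -> assoc_mod b c a -> assoc_mod c a b.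
Proof.
rewrite (Qc (b * c)) (Qc (c * a)) (Qc c a) (Qc c (a * b)) => h1 h2.
exact/mod_N_sym/(mod_N_trans h1 h2).
Qed.

(* If [inn a b] fixes the generators modulo [N] it fixes everything; by the
   symmetries of the associator this spreads from [a, b] in {x, y} to all pairs. *)
Lemma mod_N_assoc a b c : assoc_mod a b c.
Proof.
have xxy : assoc_mod x x y.
  by apply: mod_N_sym; exists u1; [apply/gen_in/Or31 | rewrite assocE].
have xyy : assoc_mod x y y.
  by apply: mod_N_sym; exists u2; [apply/gen_in/Or32 | rewrite assocE].
have flex d e : assoc_mod d e d by apply: mod_N_of_eq; rewrite Qc (Qc d e).
have g2 d e f : d = x \/ d = y -> e = x \/ e = y -> assoc_mod d e f.
  by case=> -> [] ->; apply: assoc_mod_gen => //; apply: assoc_mod_rev.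
have g1 d e f : d = x \/ d = y -> assoc_mod d e f.
  (* Rotation moves the arbitrary e from the last place to the middle. *)
  have mid d' : d = x \/ d = y -> d' = x \/ d' = y -> assoc_mod d e d'.
    by move=> h h'; apply: assoc_mod_rot (assoc_mod_rev (g2 _ _ _ _ _)) (g2 _ _ _ _ _).
  by move=> h; apply: assoc_mod_gen; apply: mid => //; [left | right].
by apply: assoc_mod_gen; apply/assoc_mod_rev/g1; [left | right].
Qed.

Lemma mod_N_abelian : abelian_mod (fun=> True) mod_N.
Proof.
split=> //.
- exact: mod_N_refl.
- exact: mod_N_sym.
- exact: mod_N_trans.
- exact: mod_N_mul.
- exact: mod_N_cancel.
- by move=> *; apply: mod_N_assoc.
Qed.

(** * Every element is a canonical word *)

Lemma central_zpow z i : central z -> central (zpow z i).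
Proof.
move=> cz; have cn (k : nat) : central (npow z k).
  by elim: k => [|k IH] /=; [apply: central1 | apply: centralM].
by case: i => k; [apply: cn | apply: centralV (cn k.+1) central1].
Qed.

Lemma canon_onto w : exists a : Z8, canon x y a = w.
Proof.
(* Modulo N, extend the trivial subloop by x and then by y: this gives w = x^i y^j n with n in N. *)
have S0 := saturated_trivial mod_N_abelian.
have Sx := saturated_extend Qc mod_N_abelian (g := x) I S0.
have Sxy := saturated_extend Qc mod_N_abelian (g := y) I Sx.
have [] : extend (fun=> True) mod_N (extend (fun=> True) mod_N
    (fun w => True /\ mod_N w 1) x) y w.
  apply: (gen_sub_saturated _ Sxy (gen_xy w)) => c [] ->.
    by apply: (sub_extend mod_N_abelian y Sx); apply: (extend_gen mod_N_abelian) => //; case: S0.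
  by apply: (extend_gen mod_N_abelian) => //; case: Sx.
move=> _ [p [j [[_ [p' [i [[_ e0] e1]]]] e2]]].
have {p p' e0 e1 e2} [n Nn ->] : mod_N (zpow x i * zpow y j) w.
  apply/mod_N_sym/(mod_N_trans e2)/mod_N_mul/mod_N_refl/(mod_N_trans e1).
  by rewrite -[X in mod_N _ X]lmul1x; apply: mod_N_mul => //; apply: mod_N_refl.
(* Equality is associative on derived elements, so n is a product of powers of u1, u2, v1, ..., v4,
   adjoined in this order. *)
have T0 := saturated_trivial derived_mod_eq.
have T1 := saturated_extend Qc derived_mod_eq (derived_assoc x x y) T0.
have T2 := saturated_extend Qc derived_mod_eq (derived_assoc x y y) T1.
have T3 := saturated_extend Qc derived_mod_eq (derived_assoc x x u1) T2.
have T4 := saturated_extend Qc derived_mod_eq (derived_assoc x x u2) T3.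
have T5 := saturated_extend Qc derived_mod_eq (derived_assoc y y u1) T4.
have T6 := saturated_extend Qc derived_mod_eq (derived_assoc y y u2) T5.
have ext1 A g : derived g -> saturated_subloop derived (@eq Q) A -> extend derived (@eq Q) A g g.
  by move=> dg [_ A1 _ _ _]; apply: (extend_gen derived_mod_eq).
have ext2 := sub_extend derived_mod_eq.
have := gen_sub_saturated _ T6 Nn; case.
  move=> a; case=> [->|->|[]->].
  (* The k-th generator lies in the extension that adjoins it and passes through the 6 - k later
     ones. *)
  - do 5!apply: (ext2) => //; exact: (ext1) (derived_assoc _ _ _) _.
  - do 4!apply: (ext2) => //; exact: (ext1) (derived_assoc _ _ _) _.
  - do 3!apply: (ext2) => //; exact: (ext1) (derived_assoc _ _ _) _.
  - do 2!apply: (ext2) => //; exact: (ext1) (derived_assoc _ _ _) _.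
  - do 1!apply: (ext2) => //; exact: (ext1) (derived_assoc _ _ _) _.
  - exact: ext1 (derived_assoc _ _ _) _.
move=> _ [p6 [i6 [[_ [p5 [i5 [[_ [p4 [i4 [[_ [p3 [i3 [[_ [p2 [i2 [[_ [p1 [i1
  [[_ ->] ->]]]] ->]]]] ->]]]] ->]]]] ->]]]] ->]]].
exists (mkZ8 i j i1 i2 i3 i4 i5 i6).
have cz v k : generator_v v -> central (zpow v k) by move/generator_v_central/central_zpow.
rewrite /canon /= lmul1x.
by rewrite !(mulAz _ _ (cz v1 _ (Or41 _ _ _ _)), mulAz _ _ (cz v2 _ (Or42 _ _ _ _)),
  mulAz _ _ (cz v3 _ (Or43 _ _ _ _)), mulAz _ _ (cz v4 _ (Or44 _ _ _ _))).
Qed.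

End TwoGenerators.
End Automorphic.

(** * Inner mappings, homomorphisms and subloops *)

Section InnerMappings.
Variable Q : loop.
Hypothesis Qc : commutative_loop Q.
Local Notation "a * b" := (lmul a b).
Local Notation "a \ b" := (lldiv a b) (at level 40, left associativity).

Lemma lrdivE (a b : Q) : lrdiv b a = a \ b.
Proof. by apply/esym/ldiv_eq; rewrite Qc rmulK. Qed.

Lemma inniE (a b c : Q) : a * (b * inni a b c) = (a * b) * c.
Proof. by rewrite /inni !lmulK. Qed.

Lemma inniK (a b c : Q) : inn a b (inni a b c) = c.
Proof. by rewrite /inn inniE lKmul. Qed.

(** A further translation is absorbed by a(c w) = (ac) [inn a c] w, and a division by the analogous
    identity for [inni]. *)
Lemma Mlt_factor (R : (Q -> Q) -> Prop) :
  R id -> (forall a b g, R g -> R (fun w => inn a b (g w))) ->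
  (forall a b g, R g -> R (fun w => inni a b (g w))) ->
  forall f, Mlt f -> exists c g, R g /\ forall w, f w = c * g w.
Proof.
move=> R1 Ri Rj f; elim=> [|a {}f _ IH|a {}f _ IH|a {}f _ IH|a {}f _ IH].
- by exists (lone Q), id; split=> // w; rewrite lmul1x.
- have [c [g [Rg e]]] := IH; exists (a * c), (fun w => inn a c (g w)).
  by split; [apply: Ri | move=> w; rewrite e innE].
- have [c [g [Rg e]]] := IH; exists (a * c), (fun w => inn a c (g w)).
  by split; [apply: Ri | move=> w; rewrite Qc e innE].
- have [c [g [Rg e]]] := IH; exists (a \ c), (fun w => inni a (a \ c) (g w)).
  split; [exact: Rj | move=> w; apply: ldiv_eq].
  by rewrite inniE lmulK e.
- have [c [g [Rg e]]] := IH; exists (a \ c), (fun w => inni a (a \ c) (g w)).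
  split; [exact: Rj | move=> w; rewrite lrdivE; apply: ldiv_eq].
  by rewrite inniE lmulK e.
Qed.

Lemma Inn_factor (R : (Q -> Q) -> Prop) :
  R id -> (forall a b g, R g -> R (fun w => inn a b (g w))) ->
  (forall a b g, R g -> R (fun w => inni a b (g w))) ->
  (forall g, R g -> g (lone Q) = lone Q) ->
  forall f, Inn f -> exists2 g, R g & f =1 g.
Proof.
move=> R1 Ri Rj Rg1 f [/(Mlt_factor R1 Ri Rj)[c [g [Rg e]]] f1].
have c1 : c = lone Q by rewrite -f1 e Rg1 // lmulx1.
by exists g => // w; rewrite e c1 lmul1x.
Qed.

End InnerMappings.

Lemma Zser1_central (Q : loop) (a : Q) : Zser 1 a <-> central a.
Proof.
split=> [H f /H [n [/= -> ->]]|H f /H fa]; first by rewrite lmulx1.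
by exists (lone Q); rewrite /= lmulx1.
Qed.

Lemma Zser2_second (Q : loop) (a : Q) : Zser 2 a -> second_central a.
Proof. by move=> H f /H [n [/Zser1_central cn e]]; exists n. Qed.

Lemma hom_one (Q R : loop) (h : Q -> R) : loop_hom h -> h (lone Q) = lone R.
Proof. by move=> hM; apply: (mulIl (a := h (lone Q))); rewrite -hM !lmulx1. Qed.

Lemma hom_ldiv (Q R : loop) (h : Q -> R) a b :
  loop_hom h -> h (lldiv a b) = lldiv (h a) (h b).
Proof. by move=> hM; apply/esym/ldiv_eq; rewrite -hM lmulK. Qed.

Lemma hom_assoc (Q R : loop) (h : Q -> R) a b c :
  loop_hom h -> h (assoc a b c) = assoc (h a) (h b) (h c).
Proof. by move=> hM; rewrite /assoc hom_ldiv // !hM. Qed.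

Lemma hom_zpow (Q R : loop) (h : Q -> R) a i :
  loop_hom h -> h (zpow a i) = zpow (h a) i.
Proof.
move=> hM; have hn n : h (npow a n) = npow (h a) n.
  by elim: n => [|n IH] /=; [apply: hom_one | rewrite hM IH].
by case: i => n; [apply: hn | rewrite [LHS]hom_ldiv // hom_one // (hn n.+1)].
Qed.

Lemma hom_canon (Q R : loop) (h : Q -> R) x y a :
  loop_hom h -> h (canon x y a) = canon (h x) (h y) a.
Proof. by move=> hM; rewrite /canon !hM !(hom_zpow _ _ hM) !(hom_assoc _ _ _ hM). Qed.

(** Powers are read off from a homomorphism from the integers that sends 1 to the given element. *)
Lemma zpow_hom (Q : loop) (t : int -> Q) :
  t 0%R = lone Q -> (forall i j, t (i + j)%R = lmul (t i) (t j)) ->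
  forall k, zpow (t 1%R) k = t k.
Proof.
move=> t0 tD; have tn n : npow (t 1%R) n = t (Posz n).
  by elim: n => [|n IH] /=; rewrite ?t0 // IH -tD -PoszD addn1.
case=> n; first exact: tn.
by rewrite /zpow tn; apply: ldiv_eq; rewrite -tD NegzE addrN t0.
Qed.

Section Subloop.
Variables (Q : loop) (A : Q -> Prop).
Hypothesis Qc : commutative_loop Q.
Let S := {w : Q | gen A w}.

Lemma gen_val_inj (s t : S) : sval s = sval t -> s = t.
Proof. by case: s t => [s ?] [t ?] /=; apply: subset_eq_compat. Qed.

Definition gen_loop : loop.
Proof.
refine (@Loop S
  (fun s t => exist _ (lmul (sval s) (sval t)) (gen_mul (proj2_sig s) (proj2_sig t)))
  (exist _ (lone Q) (gen_one A))
  (fun s t => exist _ (lldiv (sval s) (sval t)) (gen_ldiv (proj2_sig s) (proj2_sig t)))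
  (fun t s => exist _ (lldiv (sval s) (sval t)) (gen_ldiv (proj2_sig s) (proj2_sig t)))
  _ _ _ _ _ _) => *; apply: gen_val_inj => /=.
- exact: lmul1x.
- exact: lmulx1.
- exact: lmulK.
- exact: lKmul.
- by rewrite Qc lmulK.
- by rewrite Qc lKmul.
Defined.

Lemma gen_loop_commutative : commutative_loop gen_loop.
Proof. by move=> s t; apply: gen_val_inj; apply: Qc. Qed.

Lemma gen_loop_Mlt (f : gen_loop -> gen_loop) : Mlt f ->
  exists2 f' : Q -> Q, Mlt f' & forall s, sval (f s) = f' (sval s).
Proof.
elim=> [|a {}f _ [f' Mf e]|a {}f _ [f' Mf e]|a {}f _ [f' Mf e]|a {}f _ [f' Mf e]].
- by exists id; first constructor.
- by exists (fun w => lmul (sval a) (f' w)) => [|s]; [constructor | rewrite /= e].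
- by exists (fun w => lmul (f' w) (sval a)) => [|s]; [constructor | rewrite /= e].
- by exists (fun w => lldiv (sval a) (f' w)) => [|s]; [constructor | rewrite /= e].
- by exists (fun w => lldiv (sval a) (f' w)) => [|s]; [constructor | rewrite /= e].
Qed.

Lemma gen_loop_Inn (f : gen_loop -> gen_loop) : Inn f ->
  exists2 f' : Q -> Q, Inn f' & forall s, sval (f s) = f' (sval s).
Proof.
move=> [/gen_loop_Mlt[f' Mf e] f1]; exists f' => //; split=> //.
by have := e (lone gen_loop); rewrite f1.
Qed.

(** Inner mappings of the subloop are restrictions of inner mappings of Q, and the factor n lies in
    the subloop because s and s n do. *)
Lemma gen_loop_Zser i (s : gen_loop) : Zser i (sval s) -> Zser i s.
Proof.
elim: i s => [|i IH] s /= H; first exact: gen_val_inj.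
move=> f /gen_loop_Inn[f' /H[n [Zn e] e']].
have gn : gen A n.
  by apply: (gen_cancel (proj2_sig s)); rewrite -e -e'; apply: proj2_sig.
exists (exist _ n gn); split; first exact: IH.
by apply: gen_val_inj; rewrite e' e.
Qed.

Lemma gen_loop_in_variety : in_variety Q -> in_variety gen_loop.
Proof.
move=> [_ [Qa Qn]]; split; first exact: gen_loop_commutative.
split=> [f /gen_loop_Inn[f' If e] s t|s]; last exact/gen_loop_Zser/Qn.
by apply: gen_val_inj; rewrite e /= Qa // !e.
Qed.

End Subloop.

(** Map F to its subloop generated by x and y by freeness. Followed by the inclusion, this fixes x
    and y, so it is the identity by uniqueness. *)
Lemma free_on2_gen (F : loop) (x y : F) :
  free_on2 x y -> forall w, gen (fun c => c = x \/ c = y) w.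
Proof.
move=> [Fv Funiv] w; have [Fc _] := Fv; set A := fun c => _.
have gx : gen A x by apply: gen_in; left.
have gy : gen A y by apply: gen_in; right.
have Sv : in_variety (gen_loop A Fc) by apply: gen_loop_in_variety.
have [[h [hM [hx hy]]] _] := Funiv _ Sv (exist _ x gx) (exist _ y gy).
have [_ uniq] := Funiv F Fv x y.
have := uniq (fun w => sval (h w)) id.
move=> /(_ _ _ _ _ erefl erefl w) <-; first exact: proj2_sig.
- by move=> a b; rewrite hM.
- by [].
- by rewrite hx.
- by rewrite hy.
Qed.

(** * The loop on Z^8 *)

Section Z8Loop.
Local Open Scope ring_scope.

Lemma alphaE n : 3 * alpha n = n ^+ 3 - n.
Proof.
suff dvd3 : (3 %| n ^+ 3 - n)%Z by rewrite /alpha mulrC divzK.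
have step m : (3 %| (m + 1) ^+ 3 - (m + 1))%Z = (3 %| m ^+ 3 - m)%Z.
  have -> : (m + 1) ^+ 3 - (m + 1) = m ^+ 3 - m + (m ^+ 2 + m) * 3 :> int by ring.
  by rewrite rpredDr ?dvdz_mull.
elim/int_rec: n => [//|n IH|n IH]; first by rewrite -addn1 PoszD step.
by rewrite -step -addn1 PoszD opprD subrK.
Qed.

(** With [alphaN] this pushes [alpha] down to single variables, where [ring] can treat its values as
    atoms. *)
Lemma alphaD m n : alpha (m + n) = alpha m + alpha n + m * n * (m + n).
Proof.
apply: (@mulfI _ (3:int)) => //.
by rewrite !mulrDr !alphaE; ring.
Qed.

Lemma alphaN n : alpha (- n) = - alpha n.
Proof.
apply: (@mulfI _ (3:int)) => //.
by rewrite mulrN !alphaE; ring.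
Qed.

Lemma alpha0 : alpha 0 = 0. Proof. by []. Qed.

Ltac z8_ring := congr mkZ8; rewrite ?(addKr, alphaD, alphaN, alpha0) /beta; ring.

Lemma z8mulC a b : z8mul a b = z8mul b a.
Proof.
case: a b => a1 a2 a3 a4 a5 a6 a7 a8 [b1 b2 b3 b4 b5 b6 b7 b8] /=.
by z8_ring.
Qed.

(** Solved layer by layer: each coordinate of the second factor enters its own coordinate of the
    product additively, so it is corrected by the error left when it is set to 0. *)
Definition z8ldiv (a c : Z8) : Z8 :=
  let r := mkZ8 (z1 c - z1 a) (z2 c - z2 a) 0 0 0 0 0 0 in
  let p := z8mul a r in
  let r' := mkZ8 (z1 c - z1 a) (z2 c - z2 a) (z3 c - z3 p) (z4 c - z4 p) 0 0 0 0 in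
  let p' := z8mul a r' in
  mkZ8 (z1 c - z1 a) (z2 c - z2 a) (z3 c - z3 p) (z4 c - z4 p)
       (z5 c - z5 p') (z6 c - z6 p') (z7 c - z7 p') (z8 c - z8 p').

Lemma z8mulK a c : z8mul a (z8ldiv a c) = c.
Proof.
case: a c => a1 a2 a3 a4 a5 a6 a7 a8 [b1 b2 b3 b4 b5 b6 b7 b8].
by rewrite /z8ldiv /=; z8_ring.
Qed.

Lemma z8Kmul a c : z8ldiv a (z8mul a c) = c.
Proof.
case: a c => a1 a2 a3 a4 a5 a6 a7 a8 [b1 b2 b3 b4 b5 b6 b7 b8].
by rewrite /z8ldiv /=; z8_ring.
Qed.

(** A division-free form of [inn], solved by layers as in [z8ldiv]; p is a determinant in the first
    two coordinates of c and a. The automorphic law becomes a polynomial identity. *)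
Definition z8inn (a b c : Z8) : Z8 :=
  let p := z1 c * z2 a - z1 a * z2 c in
  let c' := mkZ8 (z1 c) (z2 c) (z3 c + z1 b * p) (z4 c + z2 b * p) 0 0 0 0 in
  let s := z8mul a (z8mul b c) in
  let t := z8mul (z8mul a b) c' in
  mkZ8 (z1 c) (z2 c) (z3 c + z1 b * p) (z4 c + z2 b * p)
       (z5 s - z5 t) (z6 s - z6 t) (z7 s - z7 t) (z8 s - z8 t).

Lemma z8innE a b c : z8mul (z8mul a b) (z8inn a b c) = z8mul a (z8mul b c).
Proof.
case: a b c => a1 a2 a3 a4 a5 a6 a7 a8 [b1 b2 b3 b4 b5 b6 b7 b8]
  [c1 c2 c3 c4 c5 c6 c7 c8].
by rewrite /z8inn /=; z8_ring.
Qed.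

Lemma z8innM a b c d : z8inn a b (z8mul c d) = z8mul (z8inn a b c) (z8inn a b d).
Proof.
case: a b c d => a1 a2 a3 a4 a5 a6 a7 a8 [b1 b2 b3 b4 b5 b6 b7 b8]
  [c1 c2 c3 c4 c5 c6 c7 c8] [d1 d2 d3 d4 d5 d6 d7 d8].
by rewrite /z8inn /=; z8_ring.
Qed.

Definition z8one : Z8 := mkZ8 0 0 0 0 0 0 0 0.

Lemma z8mul1x a : z8mul z8one a = a.
Proof. by case: a => *; rewrite /=; z8_ring. Qed.

Lemma z8mulx1 a : z8mul a z8one = a.
Proof. by rewrite z8mulC z8mul1x. Qed.

Definition z8loop : loop.
Proof.
refine (@Loop Z8 z8mul z8one z8ldiv (fun b a => z8ldiv a b)
  z8mul1x z8mulx1 z8mulK z8Kmul _ _) => a b.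
- by rewrite z8mulC z8mulK.
- by rewrite z8mulC z8Kmul.
Defined.

(** Automorphisms acting trivially on the layers Z^2, Z^2, Z^4 of the coordinate filtration. Being
    closed under composition and inversion, they include all inner mappings, which yields both the
    automorphic law and class at most 3. *)
Definition unipotent_automorphism (g : Z8 -> Z8) : Prop :=
  [/\ {morph g : a b / z8mul a b}, forall w, z1 (g w) = z1 w /\ z2 (g w) = z2 w,
      forall w, z1 w = 0 -> z2 w = 0 -> z3 (g w) = z3 w /\ z4 (g w) = z4 w &
      forall w, z1 w = 0 -> z2 w = 0 -> z3 w = 0 -> z4 w = 0 -> g w = w].

Lemma z8innP a b : @inn z8loop a b =1 z8inn a b.
Proof. by move=> c; apply: (@ldiv_eq z8loop); apply: z8innE. Qed.

Lemma unipotent_inn a b : unipotent_automorphism (@inn z8loop a b).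
Proof.
split=> [c d|w|w w1 w2|w].
- by rewrite !z8innP z8innM.
- by rewrite z8innP.
- by rewrite z8innP /z8inn /= w1 w2 !mul0r mulr0 subrr !mulr0 !addr0.
rewrite z8innP; case: w => c1 c2 c3 c4 c5 c6 c7 c8 /= -> -> -> ->.
case: a b => a1 a2 a3 a4 a5 a6 a7 a8 [b1 b2 b3 b4 b5 b6 b7 b8].
by rewrite /z8inn /=; z8_ring.
Qed.

Lemma unipotent_comp f g : unipotent_automorphism f -> unipotent_automorphism g ->
  unipotent_automorphism (fun w => f (g w)).
Proof.
move=> [fM f12 f34 f5] [gM g12 g34 g5]; split.
- by move=> a b; rewrite gM fM.
- by move=> w; have [-> ->] := f12 (g w).
- move=> w w1 w2; have [e1 e2] := g12 w; have [<- <-] := g34 w w1 w2.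
  by apply: f34; rewrite ?e1 ?e2.
- by move=> w w1 w2 w3 w4; rewrite g5 // f5.
Qed.

Lemma unipotent_inverse f g : cancel g f -> cancel f g ->
  unipotent_automorphism f -> unipotent_automorphism g.
Proof.
move=> gK fK [fM f12 f34 f5].
have g12 w : z1 (g w) = z1 w /\ z2 (g w) = z2 w.
  by have [] := f12 (g w); rewrite gK.
have g34 w : z1 w = 0 -> z2 w = 0 -> z3 (g w) = z3 w /\ z4 (g w) = z4 w.
  by have [<- <-] := g12 w => w1 w2; have [] := f34 (g w) w1 w2; rewrite gK.
split=> // [a b|w w1 w2 w3 w4]; first by apply: (can_inj fK); rewrite fM !gK.
have [e1 e2] := g12 w; have [e3 e4] := g34 w w1 w2.
by rewrite -[RHS]gK f5 // ?e1 ?e2 ?e3 ?e4.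
Qed.

Lemma unipotent_inni a b : unipotent_automorphism (@inni z8loop a b).
Proof.
apply: unipotent_inverse (unipotent_inn a b) => w; first exact: (@inniK z8loop).
by rewrite /inni (@innE z8loop) !(@lKmul z8loop).
Qed.

Lemma z8_Inn f : @Inn z8loop f -> exists2 g, unipotent_automorphism g & f =1 g.
Proof.
apply: (@Inn_factor z8loop z8mulC unipotent_automorphism).
- by split.
- by move=> a b g; apply: unipotent_comp (unipotent_inn a b).
- by move=> a b g; apply: unipotent_comp (unipotent_inni a b).
- by move=> g [_ _ _ ->].
Qed.

Lemma z8_in_variety : in_variety z8loop.
Proof.
split; first exact: z8mulC.
split=> [f /z8_Inn[g [gM _ _ _] fg] a b|w]; first by rewrite !fg gM.
(* The last four coordinates lie in the center and the last six in the second center, by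
   unipotency. *)
have Z1 v : z1 v = 0 -> z2 v = 0 -> z3 v = 0 -> z4 v = 0 -> @Zser z8loop 1 v.
  move=> v1 v2 v3 v4 f /z8_Inn[g [_ _ _ g5] fg]; exists z8one; split=> //.
  by rewrite fg g5 //= z8mulx1.
have Z2 v : z1 v = 0 -> z2 v = 0 -> @Zser z8loop 2 v.
  move=> v1 v2 f /z8_Inn[g [_ g12 g34 _] fg]; exists (z8ldiv v (g v)).
  rewrite fg [RHS]z8mulK; split=> //.
  have [e1 e2] := g12 v; have [e3 e4] := g34 v v1 v2.
  move: v1 v2 e1 e2 e3 e4 {fg}; case: (g v) => c1 c2 c3 c4 c5 c6 c7 c8.
  case: v => d1 d2 d3 d4 d5 d6 d7 d8 /= -> -> -> -> -> ->.
  by apply: Z1; rewrite /z8ldiv /=; ring.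
move=> f /z8_Inn[g [_ g12 _ _] fg]; exists (z8ldiv w (g w)).
rewrite fg [RHS]z8mulK; split=> //; have [e1 e2] := g12 w.
by apply: Z2; rewrite /= ?e1 ?e2 subrr.
Qed.

(** * Canonical words at the unit vectors *)

Let e1 := mkZ8 1 0 0 0 0 0 0 0.
Let e2 := mkZ8 0 1 0 0 0 0 0 0.

Lemma z8_canon a : @canon z8loop e1 e2 a = a.
Proof.
have pw t (t0 : t 0 = z8one) (tD : forall i j, t (i + j) = z8mul (t i) (t j)) k :
  @zpow z8loop (t 1) k = t k by apply: zpow_hom.
have u1E : @assoc z8loop e1 e1 e2 = mkZ8 0 0 1 0 0 0 0 0 by [].
have u2E : @assoc z8loop e1 e2 e2 = mkZ8 0 0 0 1 0 0 0 0 by [].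
rewrite /canon u1E u2E.
have -> : @assoc z8loop e1 e1 (mkZ8 0 0 1 0 0 0 0 0) = mkZ8 0 0 0 0 1 0 0 0 by [].
have -> : @assoc z8loop e1 e1 (mkZ8 0 0 0 1 0 0 0 0) = mkZ8 0 0 0 0 0 1 0 0 by [].
have -> : @assoc z8loop e2 e2 (mkZ8 0 0 1 0 0 0 0 0) = mkZ8 0 0 0 0 0 0 1 0 by [].
have -> : @assoc z8loop e2 e2 (mkZ8 0 0 0 1 0 0 0 0) = mkZ8 0 0 0 0 0 0 0 1 by [].
(* Each coordinate axis is a copy of the integers under the product, which gives the powers of its
   unit vector. *)
rewrite (pw (fun k => mkZ8 k 0 0 0 0 0 0 0)) //; last by move=> i j /=; z8_ring.
rewrite (pw (fun k => mkZ8 0 k 0 0 0 0 0 0)) //; last by move=> i j /=; z8_ring.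
rewrite (pw (fun k => mkZ8 0 0 k 0 0 0 0 0)) //; last by move=> i j /=; z8_ring.
rewrite (pw (fun k => mkZ8 0 0 0 k 0 0 0 0)) //; last by move=> i j /=; z8_ring.
rewrite (pw (fun k => mkZ8 0 0 0 0 k 0 0 0)) //; last by move=> i j /=; z8_ring.
rewrite (pw (fun k => mkZ8 0 0 0 0 0 k 0 0)) //; last by move=> i j /=; z8_ring.
rewrite (pw (fun k => mkZ8 0 0 0 0 0 0 k 0)) //; last by move=> i j /=; z8_ring.
rewrite (pw (fun k => mkZ8 0 0 0 0 0 0 0 k)) //; last by move=> i j /=; z8_ring.
by case: a => *; rewrite /=; z8_ring.
Qed.

End Z8Loop.

Theorem theorem5p4 (F : loop) (x y : F) :
  free_on2 x y ->
  (forall w : F, exists a : Z8, canon x y a = w) /\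
  (forall a b : Z8, canon x y a = canon x y b -> a = b) /\
  (exists phi : Z8 -> F,
     (forall w : F, exists a, phi a = w) /\
     (forall a b, phi a = phi b -> a = b) /\
     (forall a b, phi (z8mul a b) = lmul (phi a) (phi b))).
Proof.
move=> Fxy; have gen_xy := free_on2_gen Fxy; have [[Fc [Fa Fn]] Funiv] := Fxy.
have [[h [hM [hx hy]]] _] := Funiv _ z8_in_variety
  (mkZ8 1 0 0 0 0 0 0 0) (mkZ8 0 1 0 0 0 0 0 0).
have hcanon a : h (canon x y a) = a.
  by rewrite hom_canon // hx hy; apply: z8_canon.
have onto : forall w, exists a, canon x y a = w.
  apply: canon_onto => // f If a; have [n [Zn e]] := Fn a f If.
  by exists n => //; apply: Zser2_second.
have inj a b : canon x y a = canon x y b -> a = b.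
  by move/(congr1 h); rewrite !hcanon.
do 2!split=> //; exists (canon x y); do 2!split=> //.
(* The product of two canonical words is a canonical word with some exponents c; applying h
   identifies c as [z8mul a b]. *)
move=> a b; have [c e] := onto (lmul (canon x y a) (canon x y b)).
by rewrite -e -[c]hcanon e hM !hcanon.
Qed.
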